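(* Let $\bar\Pi=(K_7,\rho)$ be the combinatorial embedding of $K_7$ on vertex-set $\mathbb{Z}_7$ with rotation $\rho(x,y)=(x,5y-4x \bmod 7)$ for all oriented edges $(x,y)$. Its faces (obtained by face tracing) are the triangles $\{x,x+1,x+3\}$ and $\{x,x+1,x+5\}$, $x\in\mathbb{Z}_7$, and these two families of seven faces form the two color classes of a face 2-coloring. Then the group $\operatorname{Aut}(\bar\Pi,Col)$ of embedding automorphisms of $\bar\Pi$ that fix each color class is isomorphic to the Frobenius group $F_{21}$ of order 21.
   Context: For a graph $\Gamma=(\mathcal{V},\mathcal{E})$, $D(\Gamma)$ is the set of ordered pairs $(x,y),(y,x)$ for $\{x,y\}\in\mathcal{E}$, and $\mathcal{N}(\Gamma,x)$ the neighbourhood of $x$. A combinatorial embedding of a connected graph $\Gamma$ is a pair $(\Gamma,\rho)$ with $\rho:D(\Gamma)\to D(\Gamma)$ such that for each vertex $x$ there is a permutation $\rho_x$ of $\mathcal{N}(\Gamma,x)$ which is a single cycle of length $|\mathcal{N}(\Gamma,x)|$ and $\rho(x,y)=(x,\rho_x(y))$. Faces are obtained by face tracing: starting from an oriented edge $(v_0,v_1)$, set $v_{i+1}=\rho_{v_i}(v_{i-1})$ until the pair $(v_0,v_1)$ recurs; the cyclic sequence obtained is a face, and each edge $\{x,y\}$ lies in exactly two faces. An embedding automorphism of $(\Gamma,\rho)$ is a graph automorphism $\sigma$ with either $\sigma\circ\rho=\rho\circ\sigma$ on $D(\Gamma)$ or $\sigma\circ\rho=\rho^{-1}\circ\sigma$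 on $D(\Gamma)$ (where $\sigma(x,y)=(\sigma(x),\sigma(y))$). A face 2-coloring colors faces with two colors so every edge lies in two faces of different colors; $\operatorname{Aut}(\Pi,Col)$ denotes the embedding automorphisms mapping each color class onto itself. *)

(* Defs.v *)
From HB Require Import structures.
From mathcomp Require Import all_boot all_order all_fingroup all_algebra.
From mathcomp Require Import all_solvable.

Set Implicit Arguments.
Unset Strict Implicit.
Unset Printing Implicit Defensive.

Import GRing.Theory.
Import GroupScope.

Record sgraph := SGraph {
  vertex :> finType;
  adj : rel vertex;
  adj_sym : symmetric adj;
  adj_irr : irreflexive adj
}.

Section Embeddings.

Variable G : sgraph.

Definition nbhd (x : G) : {set G} := [set y | adj x y].

Definition connected_graph : Prop := forall x y : G, connect (@adj G) x y.

Definition graph_aut (s : {perm G}) : bool :=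
  [forall x : G, forall y : G, adj (s x) (s y) == adj x y].

Definition dart : Type := {p : G * G | adj p.1 p.2}.

Fact rev_dart_subproof (d : dart) :
  adj ((val d).2, (val d).1).1 ((val d).2, (val d).1).2.
Proof. by rewrite /= adj_sym (valP d). Qed.

Definition rev_dart (d : dart) : dart :=
  exist _ ((val d).2, (val d).1) (rev_dart_subproof d).

(* The default value of [insubd] is reached only when [s] is not a graph      *)
(* automorphism.                                                              *)
Definition dart_im (s : {perm G}) (d : dart) : dart :=
  insubd d (s (val d).1, s (val d).2).

(* A permutation of [nbhd x] is encoded as a permutation of [G] supported on  *)
(* [nbhd x]; it is a single cycle of length [#|nbhd x|] iff all its orbits on *)
(* [nbhd x] are equal to [nbhd x].                                            *)
Definition rotation_axiom (rho : dart -> dart) : Prop :=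
  forall x : G, exists rho_x : {perm G},
    [/\ perm_on (nbhd x) rho_x,
        {in nbhd x, forall y, porbit rho_x y = nbhd x}
      & forall d : dart, (val d).1 = x -> val (rho d) = (x, rho_x (val d).2)].

Record comb_embedding := CombEmbedding {
  rho :> dart -> dart;
  comb_embedding_connected : connected_graph;
  comb_embedding_rotation : rotation_axiom rho
}.

Variable P : comb_embedding.

(* One step (v_(i-1), v_i) |-> (v_i, v_(i+1)) of face tracing, where          *)
(* v_(i+1) = rho_(v_i) (v_(i-1)).                                             *)
Definition trace_step (d : dart) : dart := P (rev_dart d).

(* The face traced from [d], i.e. the cyclic sequence (v_0, ..., v_(n-1)), is *)
(* represented by the set of its darts (v_i, v_(i+1)).                        *)
Definition face_of (d : dart) : {set dart} := [set d' | fconnect trace_step d d'].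

Definition faces : {set {set dart}} := [set face_of d | d : dart].

Definition face_vertices (F : {set dart}) : {set G} := [set (val d).1 | d in F].

Definition rho_preserving (s : {perm G}) : bool :=
  [forall d : dart, dart_im s (P d) == P (dart_im s d)].

(* [finv P] is the inverse of [P], which is injective: see [rho_inj].         *)
Definition rho_reversing (s : {perm G}) : bool :=
  [forall d : dart, dart_im s (P d) == finv P (dart_im s d)].

Definition emb_aut (s : {perm G}) : bool :=
  graph_aut s && (rho_preserving s || rho_reversing s).

(* A rho-reversing automorphism maps the cyclic sequence of a face to that of *)
(* a face traced backwards, hence the darts have to be reversed.              *)
Definition face_im (s : {perm G}) (F : {set dart}) : {set dart} :=
  if rho_preserving s then dart_im s @: F
  else rev_dart @: (dart_im s @: F).

(* The two faces containing the edge {x, y} are those traced through (x, y)   *)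
(* and through (y, x).                                                        *)
Definition face_2coloring (col : {set dart} -> bool) : Prop :=
  forall d : dart, col (face_of d) != col (face_of (rev_dart d)).

Definition color_class (col : {set dart} -> bool) (c : bool) : {set {set dart}} :=
  [set F in faces | col F == c].

Definition col_aut (col : {set dart} -> bool) : {set {perm G}} :=
  [set s | emb_aut s &
           [forall c : bool, face_im s @: color_class col c == color_class col c]].

Lemma rho_inj : injective P.
Proof.
move=> d d' eqPd.
have [r [_ _ rE]] := comb_embedding_rotation P (val d).1.
have [r' [_ _ rE']] := comb_embedding_rotation P (val d').1.
have := rE d erefl; rewrite eqPd rE' // => -[e1 _].
have := rE d' e1; rewrite -eqPd (rE d erefl) => -[/perm_inj e2].
by apply: val_inj; rewrite [LHS]surjective_pairing [RHS]surjective_pairing e1 e2.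
Qed.

Lemma dart_imE s d : graph_aut s ->
  val (dart_im s d) = (s (val d).1, s (val d).2).
Proof.
move=> /forallP/(_ (val d).1)/forallP/(_ (val d).2)/eqP sd.
by rewrite /dart_im insubdK // unfold_in /= sd (valP d).
Qed.

Lemma graph_autM s t : graph_aut s -> graph_aut t -> graph_aut (s * t).
Proof.
move=> /'forall_forallP sP /'forall_forallP tP.
apply/'forall_forallP=> x y; rewrite !permM.
by rewrite (eqP (tP _ _)) (eqP (sP _ _)).
Qed.

Lemma dart_imM s t d : graph_aut s -> graph_aut t ->
  dart_im (s * t) d = dart_im t (dart_im s d).
Proof.
move=> sP tP; apply: val_inj.
by rewrite !dart_imE ?graph_autM //= !permM.
Qed.

Lemma dart_im1 d : dart_im 1 d = d.
Proof. by rewrite /dart_im !perm1 -surjective_pairing valKd. Qed.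

Lemma dart_im_rev s d : graph_aut s ->
  dart_im s (rev_dart d) = rev_dart (dart_im s d).
Proof. by move=> sP; apply: val_inj; rewrite /= !dart_imE. Qed.

Lemma rev_dartK : involutive rev_dart.
Proof. by move=> d; apply: val_inj; rewrite /= -surjective_pairing. Qed.

Lemma dart_im_set1 (A : {set dart}) : dart_im 1 @: A = A.
Proof. by rewrite (eq_imset _ dart_im1) imset_id. Qed.

Lemma preservingM s t : graph_aut s -> graph_aut t -> rho_preserving s ->
  rho_preserving (s * t) = rho_preserving t.
Proof.
move=> gs gt /forallP ps; apply/forallP/forallP => H d; last first.
  by rewrite !dart_imM // (eqP (ps d)) (eqP (H _)).
have inj_s : injective (dart_im s).
  move=> d1 d2 /(congr1 val); rewrite !dart_imE // => -[/perm_inj e1 /perm_inj e2].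
  by apply: val_inj; rewrite [LHS]surjective_pairing [RHS]surjective_pairing e1 e2.
rewrite -[d](f_finv inj_s); set d0 := finv _ _.
by rewrite -(eqP (ps _)) -!dart_imM // (eqP (H _)).
Qed.

Lemma reversingM s t : graph_aut s -> graph_aut t -> rho_reversing s ->
  rho_reversing t -> rho_preserving (s * t).
Proof.
move=> gs gt /forallP rs /forallP rt; apply/forallP => d.
rewrite !dart_imM // (eqP (rs d)); set d' := dart_im s d.
have := rt (finv P d'); rewrite f_finv; last exact: rho_inj.
by move/eqP->; rewrite f_finv //; apply: rho_inj.
Qed.

Lemma preserving_reversing s t : graph_aut s -> graph_aut t ->
  rho_preserving s -> rho_reversing t -> rho_reversing (s * t).
Proof.
move=> gs gt /forallP ps /forallP rt; apply/forallP => d.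
by rewrite !dart_imM // (eqP (ps d)) (eqP (rt _)).
Qed.

Lemma reversing_preserving s t : graph_aut s -> graph_aut t ->
  rho_reversing s -> rho_preserving t -> rho_reversing (s * t).
Proof.
move=> gs gt /forallP rs /forallP pt; apply/forallP => d.
rewrite !dart_imM // (eqP (rs d)); set d' := dart_im s d.
apply/eqP/rho_inj; rewrite f_finv; last exact: rho_inj.
by rewrite -(eqP (pt _)) f_finv //; apply: rho_inj.
Qed.

Lemma preservingMr s t : graph_aut s -> graph_aut t -> rho_preserving t ->
  rho_preserving (s * t) -> rho_preserving s.
Proof.
move=> gs gt /forallP pt /forallP H; apply/forallP => d.
have inj_t : injective (dart_im t).
  move=> d1 d2 /(congr1 val); rewrite !dart_imE // => -[/perm_inj e1 /perm_inj e2].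
  by apply: val_inj; rewrite [LHS]surjective_pairing [RHS]surjective_pairing e1 e2.
apply/eqP/inj_t; move: (H d); rewrite !dart_imM // => /eqP->.
by rewrite (eqP (pt _)).
Qed.

Lemma emb_autM s t : emb_aut s -> emb_aut t -> emb_aut (s * t).
Proof.
case/andP=> gs hs /andP[gt ht]; rewrite /emb_aut graph_autM //=.
case/orP: hs => hs; case/orP: ht => ht.
- by rewrite preservingM // ht.
- by rewrite (preserving_reversing gs gt) ?orbT.
- by rewrite (reversing_preserving gs gt) ?orbT.
- by rewrite (reversingM gs gt).
Qed.

Lemma face_imM s t F : emb_aut s -> emb_aut t ->
  face_im (s * t) F = face_im t (face_im s F).
Proof.
case/andP=> gs hs /andP[gt ht].
have imM (A : {set dart}) : dart_im (s * t) @: A = dart_im t @: (dart_im s @: A).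
  by rewrite -imset_comp; apply: eq_imset => d /=; rewrite dart_imM.
have revM (A : {set dart}) :
    dart_im t @: (rev_dart @: A) = rev_dart @: (dart_im t @: A).
  by rewrite -!imset_comp; apply: eq_imset => d /=; rewrite dart_im_rev.
rewrite /face_im.
have [ps|nps] := boolP (rho_preserving s); first by rewrite preservingM // !imM.
have {hs} rs : rho_reversing s by rewrite (negPf nps) in hs.
have [pt|npt] := boolP (rho_preserving t).
  have /negPf-> : ~~ rho_preserving (s * t).
    by apply: contra nps; apply: preservingMr.
  by rewrite revM imM.
have rt : rho_reversing t by rewrite (negPf npt) in ht.
rewrite (reversingM gs gt) // revM imM -!imset_comp.
by apply: eq_imset => d /=; rewrite rev_dartK.
Qed.

Lemma col_aut_group_set col : group_set (col_aut col).
Proof.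
have p1 : rho_preserving 1 by apply/forallP => d; rewrite !dart_im1.
apply/group_setP; split=> [|s t].
  rewrite inE; apply/andP; split.
    rewrite /emb_aut p1 andbT.
    by apply/'forall_forallP => x y; rewrite !perm1.
  apply/forallP => c; rewrite /face_im p1.
  by rewrite (eq_imset _ dart_im_set1) imset_id.
rewrite !inE => /andP[es /forallP fs] /andP[et /forallP ft].
rewrite emb_autM //=; apply/forallP => c; apply/eqP.
rewrite -[RHS](eqP (ft c)) -{2}(eqP (fs c)) -imset_comp.
by apply: eq_imset => F /=; rewrite face_imM.
Qed.

Canonical col_aut_group col := Group (col_aut_group_set col).

End Embeddings.

Section K7.

Local Open Scope ring_scope.

Definition K7_adj : rel 'Z_7 := fun x y => x != y.

Fact K7_adj_sym : symmetric K7_adj.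
Proof. by move=> x y; rewrite /K7_adj eq_sym. Qed.

Fact K7_adj_irr : irreflexive K7_adj.
Proof. by move=> x; rewrite /K7_adj eqxx. Qed.

Definition K7 : sgraph := SGraph K7_adj_sym K7_adj_irr.

Definition K7_rot (x y : 'Z_7) : 'Z_7 := 5 * y - 4 * x.

Fact K7_rot_inj x : injective (K7_rot x).
Proof.
have e : forall y, 3 * (K7_rot x y + 4 * x) = y.
  move=> y; rewrite /K7_rot subrK mulrA.
  by rewrite (_ : 3 * 5 = 1 :> 'Z_7) ?mul1r //; apply: val_inj.
by move=> y z yz; rewrite -(e y) yz e.
Qed.

Fact K7_rot_id x : K7_rot x x = x.
Proof. by rewrite /K7_rot -mulrBl (_ : 5 - 4 = 1 :> 'Z_7) ?mul1r //; apply: val_inj. Qed.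

Fact K7_rho_subproof (d : dart K7) :
  @adj K7 ((val d).1, K7_rot (val d).1 (val d).2).1
          ((val d).1, K7_rot (val d).1 (val d).2).2.
Proof.
rewrite /= /K7_adj; apply: contra (valP d) => /eqP e.
by apply/eqP/(@K7_rot_inj (val d).1); rewrite K7_rot_id.
Qed.

Definition K7_rho (d : dart K7) : dart K7 :=
  exist _ ((val d).1, K7_rot (val d).1 (val d).2) (K7_rho_subproof d).

Fact K7_connected : connected_graph K7.
Proof.
move=> x y; have [->|nxy] := eqVneq x y; first exact: connect0.
exact: connect1.
Qed.

Fact K7_rotation : rotation_axiom K7_rho.
Proof.
move=> x; exists (perm (@K7_rot_inj x)); split.
- apply/subsetP => y; rewrite !inE permE.
  by apply: contra => /eqP <-; rewrite K7_rot_id.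
- move=> y; rewrite inE => nxy; apply/setP => z; rewrite inE.
  have itE i t : (perm (@K7_rot_inj x) ^+ i)%g t = iter i (K7_rot x) t.
    by rewrite permX; apply: eq_iter => u; rewrite permE.
  apply/porbitP/idP => [[i ->]|nxz].
    rewrite itE; elim: i => //= i IHi; apply: contra IHi => /eqP e.
    by apply/eqP/(@K7_rot_inj x); rewrite K7_rot_id.
  suff /hasP[i _ /eqP e] : has (fun i => iter i (K7_rot x) y == z) (iota 0 6).
    by exists i; rewrite itE.
  have : all (fun x : 'Z_7 => all (fun y : 'Z_7 => all (fun z : 'Z_7 =>
     (x != y) ==> (x != z) ==>
     has (fun i => iter i (K7_rot x) y == z) (iota 0 6))
       [seq inZp i | i <- iota 0 7]) [seq inZp i | i <- iota 0 7])
       [seq inZp i | i <- iota 0 7] by vm_compute.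
  have mem (t : 'Z_7) : t \in [seq inZp i | i <- iota 0 7].
    by apply/mapP; exists (val t); rewrite ?mem_iota ?ltn_ord // valZpK.
  move/allP/(_ x (mem x))/allP/(_ y (mem y))/allP/(_ z (mem z)).
  by move/implyP/(_ nxy)/implyP/(_ nxz).
- by move=> d <-; rewrite permE.
Qed.

Definition K7_embedding : comb_embedding K7 :=
  CombEmbedding K7_connected K7_rotation.

Definition triangles3 : {set {set K7}} :=
  [set [set x; x + 1; x + 3] | x : 'Z_7].

Definition triangles5 : {set {set K7}} :=
  [set [set x; x + 1; x + 5] | x : 'Z_7].

Definition K7_col (F : {set dart K7}) : bool := face_vertices F \in triangles3.

End K7.

(* The semidirect product of 'Z_7 by 'Z_3 with a generator of 'Z_3 acting on  *)
(* 'Z_7 as multiplication by 2.                                               *)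
Definition F21 : {group Extremal.gtype 7 3 2} := [set: Extremal.gtype 7 3 2]%G.

Lemma card_F21 : #|F21| = 21.
Proof. by rewrite Extremal.card. Qed.

Lemma F21_Frobenius : [Frobenius F21].
Proof.
have /isoGrp_hom/existsP[[x y] /= /eqP[defG x7 y3 xy]] :
    [set: Extremal.gtype 7 3 2] \isog Grp (x : y : x ^+ 7, y ^+ 3, x ^ y = x ^+ 2).
  apply: Extremal.Grp => //.
  have u2 : (2%:R : 'Z_#[Zp1 : 'Z_7])%R \is a GRing.unit.
    by rewrite order_Zp1 unitZpE.
  exists (Zp_unitm (FinRing.unit _ u2)); split; first exact: Aut_aut.
    rewrite order_injm ?injm_Zp_unitm ?inE // order_dvdn.
    apply/eqP/val_inj; rewrite /= order_Zp1 /=.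
    by apply: val_inj.
  by rewrite autE ?cycle_id //= order_Zp1.
have nxy : <[y]> \subset 'N(<[x]>) by rewrite norms_cycle xy mem_cycle.
have oG : #|<[x]> * <[y]>| = 21 by rewrite -norm_joinEr // defG; exact: card_F21.
have := dvdn_cardMg <[x]> <[y]>; rewrite oG.
have /primeP[_ /(_ #[x])] : prime 7 by [].
rewrite order_dvdn x7 eqxx => /(_ isT) ox.
have /primeP[_ /(_ #[y])] : prime 3 by [].
rewrite order_dvdn y3 eqxx => /(_ isT) oy.
rewrite -!orderE; case/orP: ox => /eqP ox; case/orP: oy => /eqP oy;
  rewrite ox oy // => _.
have tixy : <[x]> :&: <[y]> = 1 by rewrite coprime_TIg // -!orderE ox oy.
suff: [Frobenius F21 = <[x]> ><| <[y]>] by apply: FrobeniusW.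
apply/prime_FrobeniusP; first by rewrite -cardG_gt1 -orderE ox.
  by rewrite -orderE oy.
split; first by rewrite sdprodE // -norm_joinEr.
apply: prime_TIg; first by rewrite -orderE ox.
rewrite cycle_subG; apply/negP => /centP/(_ y (cycle_id y)) cxy.
move: xy; rewrite conjgE cxy mulKg expgS expg1 => /(congr1 (mulg x^-1)).
by rewrite mulVg mulKg => x1; rewrite -x1 order1 in ox.
Qed.

(* Main.v *)
Require Import Defs.
From HB Require Import structures.
From mathcomp Require Import all_boot all_order all_fingroup all_algebra.
From mathcomp Require Import all_solvable.

(** Face tracing sends the dart [(x, x + e)] to [(x + e, x + 3e)], so the
    successive differences along a face are [e], [2e], [4e] and back to
    [8e = e]: every face is a triangle [{x, x + e, x + 3e}], and its color tells
    whether [e] is one of the nonzero squares 1, 2, 4 modulo 7.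

    Commuting with the rotation reads [s (5y - 4x) = 5 (s y) - 4 (s x)], which
    forces [s t = a t + b] because 5 generates the units modulo 7; inverting the
    rotation reads [5 (s (5y - 4x)) - 4 (s x) = s y], which has only constant
    solutions.  Colors are kept exactly when [a] is a square, so the group is
    generated by [t |-> t + 1] and [t |-> 2 t].  These satisfy the defining
    relations of [F21], and their orders 7 and 3 force the group to have order
    21. *)

Set Implicit Arguments.
Unset Strict Implicit.
Unset Printing Implicit Defensive.

Section HeawoodEmbedding.

Import GRing.Theory.
Import GroupScope.
Local Open Scope ring_scope.

(** * Exhaustive checking over Z_7 *)

(** Ranging over an explicit list lets [vm_compute] evaluate the test, where the enumeration of a
    finite type would get stuck. *)
Definition all7 (p : pred 'Z_7) : bool := all p [seq inZp i | i <- iota 0 7].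

Lemma all7P (p : pred 'Z_7) : reflect (forall x, p x) (all7 p).
Proof.
apply: (iffP allP) => [H x|H x _]; last exact: H.
apply: H; apply/mapP.
by exists (val x); rewrite ?mem_iota ?ltn_ord // valZpK.
Qed.

Lemma all7_2 (p : rel 'Z_7) :
  all7 (fun x => all7 (p x)) -> forall x y, p x y.
Proof. by move=> /all7P H x; apply/all7P. Qed.

Lemma all7_3 (p : 'Z_7 -> rel 'Z_7) :
  all7 (fun x => all7 (fun y => all7 (p x y))) -> forall x y z, p x y z.
Proof. by move=> /all7P H x; apply: all7_2. Qed.

Lemma all7_4 (p : 'Z_7 -> 'Z_7 -> rel 'Z_7) :
  all7 (fun x => all7 (fun y => all7 (fun z => all7 (p x y z)))) ->
  forall x y z t, p x y z t.
Proof. by move=> /all7_2 H x y; apply: all7_2. Qed.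

(** Mutual inclusion of lists: a computable substitute for equality of sets. *)
Definition eq3 (T : eqType) (a b c a' b' c' : T) : bool :=
  all (mem [:: a'; b'; c']) [:: a; b; c] &&
  all (mem [:: a; b; c]) [:: a'; b'; c'].

Lemma eq_set3 (T : finType) (a b c a' b' c' : T) :
  ([set a; b; c] == [set a'; b'; c']) = eq3 a b c a' b' c'.
Proof.
have sub3 (u v w u' v' w' : T) : ([set u; v; w] \subset [set u'; v'; w']) =
    all (mem [:: u'; v'; w']) [:: u; v; w].
  by rewrite !subUset !sub1set /= !inE andbT -!orbA andbA.
by rewrite eqEsubset !sub3.
Qed.

Lemma card_set3 (T : finType) (a b c : T) :
  uniq [:: a; b; c] -> #|[set a; b; c]| = 3%N.
Proof.
by move/card_uniqP => /= <-; apply: eq_card => u; rewrite !inE orbA.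
Qed.

Definition square7 (e : 'Z_7) : bool := e \in [:: 1; 2; 4].

(** * Faces as traced triangles *)

Local Notation P := K7_embedding.
Local Notation step := (trace_step P).

Definition K7_dart (x y : 'Z_7) (xy : x != y) : dart K7 :=
  exist (fun p : K7 * K7 => adj p.1 p.2) (x, y) xy.

Lemma val_step (d : dart K7) :
  val (step d) = ((val d).2, K7_rot (val d).2 (val d).1).
Proof. by []. Qed.

(** Darts carry adjacency proofs; on the underlying pairs, distinctness and membership become
    computations. *)
Lemma map_val_steps (d : dart K7) (x := (val d).1) (y := (val d).2)
    (z := K7_rot y x) :
  [seq val u | u <- [:: d; step d; step (step d)]] =
  [:: (x, y); (y, z); (z, K7_rot z y)].
Proof. by rewrite /x /y; case: d @x @y @z => -[]. Qed.

Lemma step3 (d : dart K7) : step (step (step d)) = d.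
Proof.
apply: val_inj; rewrite !val_step /=; case: d => -[x y] /= _.
by apply/eqP; move: x y; apply: all7_2; vm_compute.
Qed.

Lemma face_ofE (d : dart K7) : face_of P d = [set d; step d; step (step d)].
Proof.
apply/setP => d'; rewrite !inE; apply/idP/idP.
  move/iter_findex <-; elim: (findex _ _ _) => [|n]; first by rewrite eqxx.
  rewrite iterS; move: (iter _ _ _) => u.
  by case/orP=> [/orP[]|] /eqP->; rewrite ?step3 eqxx ?orbT.
case/orP=> [/orP[]|] /eqP->; first exact: connect0.
  exact: fconnect1.
exact: (fconnect_iter step 2 d).
Qed.

Lemma face_of_in_faces (d : dart K7) : face_of P d \in faces P.
Proof. exact: imset_f. Qed.

Lemma facesP F : reflect (exists d, F = face_of P d) (F \in faces P).
Proof. by apply: (iffP imsetP) => [[d _ ->]|[d ->]]; exists d. Qed.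

Lemma face_verticesE (d : dart K7) :
  face_vertices (face_of P d) =
  [set (val d).1; (val d).2; K7_rot (val d).2 (val d).1].
Proof. by rewrite /face_vertices face_ofE !imsetU !imset_set1 !val_step. Qed.

Lemma card_face F : F \in faces P -> #|F| = 3%N.
Proof.
case/facesP=> d ->; rewrite face_ofE.
apply: card_set3; rewrite -(map_inj_uniq val_inj) map_val_steps.
case: d => -[x y] /= xy; apply: (implyP _ xy); move: x y {xy}.
by apply: all7_2; vm_compute.
Qed.

(** The face through the edge {x, x + e} has third vertex x + 3e or x - 2e according to the
    direction, and these differ. So two faces on the same three vertices trace a common edge in the
    same direction. *)
Lemma face_vertices_inj : {in faces P &, injective (@face_vertices K7)}.
Proof.
move=> _ _ /facesP[d ->] /facesP[d' ->] /eqP.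
rewrite !face_verticesE eq_set3 => eq_dd'.
suff: d' \in face_of P d.
  rewrite !face_ofE !inE => /orP[/orP[]|] /eqP->; rewrite ?step3 //.
    by rewrite -[LHS]setUA [LHS]setUC.
  by rewrite -[RHS]setUA [RHS]setUC.
have: val d' \in [seq val u | u <- [:: d; step d; step (step d)]].
  rewrite map_val_steps; move: eq_dd'.
  case: d d' => -[x y] /= xy [[z t] /= zt]; apply/implyP.
  apply: (implyP _ zt); apply: (implyP _ xy); move: x y z t {xy zt}.
  by apply: all7_4; vm_compute.
by rewrite (mem_map val_inj) face_ofE !inE orbA.
Qed.

(** * Color classes and the two families of triangles *)

(** Existence of x is phrased as a failed [all7], which computes. *)
Lemma mem_triangles (k a b c : 'Z_7) :
  ([set a; b; c] \in [set [set x; x + 1; x + k] | x : 'Z_7]) =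
  ~~ all7 (fun x => ~~ eq3 a b c x (x + 1) (x + k)).
Proof.
apply/imsetP/idP => [[x _ /eqP]|/allPn[x _ /negPn]].
  by rewrite eq_set3 => e; apply/negP => /all7P/(_ x); rewrite e.
by rewrite -eq_set3 => /eqP->; exists x.
Qed.

(** Among the successive differences e, 2e, 4e one is 1 if e is a square, giving z, z + 1, z + 3,
    and one is 5 otherwise, giving z, z + 5, z + 1. *)
Lemma mem_triangles3 (x y : 'Z_7) : x != y ->
  ([set x; y; K7_rot y x] \in triangles3) = square7 (y - x).
Proof.
move=> xy; rewrite mem_triangles; apply/eqP; apply: (implyP _ xy).
by move: x y {xy}; apply: all7_2; vm_compute.
Qed.

Lemma mem_triangles5 (x y : 'Z_7) : x != y ->
  ([set x; y; K7_rot y x] \in triangles5) = ~~ square7 (y - x).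
Proof.
move=> xy; rewrite mem_triangles; apply/eqP; apply: (implyP _ xy).
by move: x y {xy}; apply: all7_2; vm_compute.
Qed.

Lemma K7_col_face (d : dart K7) :
  K7_col (face_of P d) = square7 ((val d).2 - (val d).1).
Proof. by rewrite /K7_col face_verticesE mem_triangles3 //; apply: (valP d). Qed.

(** Here -1 is not a square modulo 7. Reversing a dart negates its difference, whence the
    2-coloring. *)
Lemma square7N (e : 'Z_7) : e != 0 -> square7 (- e) = ~~ square7 e.
Proof.
move=> e0; apply/eqP; apply: (implyP _ e0); move: e {e0}.
by apply/all7P; vm_compute.
Qed.

Lemma K7_face_2coloring : face_2coloring P K7_col.
Proof.
move=> d; rewrite !K7_col_face /= -opprB square7N.
  by case: (square7 _).
by rewrite subr_eq0; apply: (valP d).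
Qed.

Lemma color_classP c F :
  reflect (exists2 d : dart K7,
             F = face_of P d & square7 ((val d).2 - (val d).1) = c)
          (F \in color_class P K7_col c).
Proof.
rewrite inE; apply: (iffP andP) => [[/facesP[d ->]]|[d -> <-]].
  by rewrite K7_col_face => /eqP; exists d.
by rewrite face_of_in_faces K7_col_face.
Qed.

(* The triangle [{x, x + 1, x + 5}] is traced as [(x, x + 5, x + 1)]. *)
Lemma color_class_triangles c :
  @face_vertices K7 @: color_class P K7_col c =
  if c then triangles3 else triangles5.
Proof.
apply/setP => T; apply/imsetP/idP => [[_ /color_classP[d -> <-] ->]|].
  rewrite face_verticesE; have := valP d; case: (boolP (square7 _)) => sq xy.
    by rewrite mem_triangles3.
  by rewrite mem_triangles5.
case: c => /imsetP[x _ ->].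
  have xy : x != x + 1 by move: x; apply/all7P; vm_compute.
  exists (face_of P (K7_dart xy)).
    by apply/color_classP; exists (K7_dart xy); rewrite //= addrC addKr.
  apply/eqP; rewrite face_verticesE eq_set3 /=; move: x {xy}.
  by apply/all7P; vm_compute.
have xy : x != x + 5 by move: x; apply/all7P; vm_compute.
exists (face_of P (K7_dart xy)).
  by apply/color_classP; exists (K7_dart xy); rewrite //= addrC addKr.
apply/eqP; rewrite face_verticesE eq_set3 /=; move: x {xy}.
by apply/all7P; vm_compute.
Qed.

(** Vertex sets separate faces, so it is enough to count the seven distinct translates of a
    triangle. *)
Lemma card_color_class c : #|color_class P K7_col c| = 7%N.
Proof.
have <- : #|@face_vertices K7 @: color_class P K7_col c| =
          #|color_class P K7_col c|.
  apply: card_in_imset => F F' /setIdP[FP _] /setIdP[F'P _].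
  exact: face_vertices_inj.
rewrite color_class_triangles -[RHS](card_ord 7).
case: c; apply: card_imset => x y /eqP; rewrite eq_set3 => e; apply/eqP;
  apply: (implyP _ e); move: x y {e}; apply: all7_2; by vm_compute.
Qed.

Lemma faces_color_class :
  faces P = color_class P K7_col true :|: color_class P K7_col false.
Proof.
by apply/setP => F; rewrite !inE; case: (K7_col F); rewrite ?andbT ?andbF ?orbF.
Qed.

(** * Embedding automorphisms as affine maps *)

Lemma K7_graph_aut (s : {perm K7}) : graph_aut s.
Proof.
by apply/'forall_forallP => x y; rewrite /adj /= /K7_adj (inj_eq perm_inj).
Qed.

Lemma K7_dart_imE (s : {perm K7}) d :
  val (dart_im s d) = (s (val d).1, s (val d).2).
Proof. exact/dart_imE/K7_graph_aut. Qed.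

Lemma K7_dart_im_inj (s : {perm K7}) : injective (dart_im s).
Proof.
move=> d d' /(congr1 val); rewrite !K7_dart_imE => -[/perm_inj e1 /perm_inj e2].
by apply: val_inj; rewrite [LHS]surjective_pairing [RHS]surjective_pairing e1 e2.
Qed.

Lemma K7_preservingP (s : {perm K7}) :
  reflect (forall x y : 'Z_7, s (K7_rot x y) = K7_rot (s x) (s y))
          (rho_preserving P s).
Proof.
apply: (iffP forallP) => [H x y|H d].
  have [->|xy] := eqVneq x y; first by rewrite !K7_rot_id.
  have /eqP/(congr1 val) := H (K7_dart xy).
  by rewrite [RHS]/= !K7_dart_imE /= => -[].
by apply/eqP/val_inj; rewrite [RHS]/= !K7_dart_imE /= H.
Qed.

Lemma K7_reversingP (s : {perm K7}) : rho_reversing P s ->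
  forall x y : 'Z_7, K7_rot (s x) (s (K7_rot x y)) = s y.
Proof.
move/forallP=> H x y.
have [->|xy] := eqVneq x y; first by rewrite !K7_rot_id.
have /eqP/(congr1 P) := H (K7_dart xy).
rewrite f_finv; last exact: rho_inj.
by move/(congr1 val); rewrite [LHS]/= !K7_dart_imE /= => -[].
Qed.

Lemma K7_no_reversing (s : {perm K7}) : ~~ rho_reversing P s.
Proof.
apply/negP => /K7_reversingP H.
(* The inverse rotation at x: 3 is the inverse of 5 modulo 7. *)
have inv (x y : 'Z_7) : K7_rot x (3 * y + 5 * x) = y.
  by apply/eqP; move: x y; apply: all7_2; vm_compute.
have rotE (x y z : 'Z_7) : K7_rot x y == z -> s z = 3 * s y + 5 * s x.
  by move=> /eqP <-; apply: (@K7_rot_inj (s x)); rewrite H inv.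
(* Turning around 0 along 1, 5, 4, 6, 2 expresses these values of [s] through [s 0] and [s 1]. The
   rotation at 1 gives a second value for [s 6], and comparing the two forces [s 0 = s 1]. *)
have e5 := rotE 0 1 5 isT; have e4 := rotE 0 5 4 isT; have e6 := rotE 0 4 6 isT.
have e2 := rotE 0 6 2 isT; have e6' := rotE 1 2 6 isT.
suff /perm_inj : s 0 = s 1 by [].
move/eqP: e6'; rewrite e2 e6 e4 e5.
move: (s 0) (s 1) => u v; move/(implyP _) => H'; apply/eqP/H'; move: u v {H'}.
by apply: all7_2; vm_compute.
Qed.

Lemma K7_preserving_affine (s : {perm K7}) : rho_preserving P s ->
  forall t : 'Z_7, s t = (s 1 - s 0) * t + s 0.
Proof.
move/K7_preservingP => H t.
have [->|t0] := eqVneq t 0; first by rewrite mulr0 add0r.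
(* [K7_rot 0] is multiplication by the primitive root 5, so its iterates from 1 reach every nonzero
   [t]. *)
have powE k : s (iter k (K7_rot 0) 1) = iter k (K7_rot (s 0)) (s 1).
  by elim: k => //= k IHk; rewrite H IHk.
have [k /eqP <-] : exists k, iter k (K7_rot 0) 1 == t.
  suff /hasP[k _ kt] : has (fun k => iter k (K7_rot 0) 1 == t) (iota 0 6).
    by exists k.
  by apply: (implyP _ t0); move: t {t0}; apply/all7P; vm_compute.
rewrite powE; elim: k => [|k] /=; first by rewrite mulr1 subrK.
move: (iter _ _ _) (iter _ _ _) => w r ->; apply/eqP.
by move: (s 1) (s 0) w; apply: all7_3; vm_compute.
Qed.

Lemma face_im_face_of (s : {perm K7}) d : rho_preserving P s ->
  face_im P s (face_of P d) = face_of P (dart_im s d).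
Proof.
move=> ps; rewrite /face_im ps !face_ofE !imsetU !imset_set1.
have stepE u : dart_im s (step u) = step (dart_im s u).
  by rewrite /trace_step -dart_im_rev ?K7_graph_aut // (eqP (forallP ps _)).
by rewrite !stepE.
Qed.

Lemma K7_col_autP (s : {perm K7}) :
  reflect (exists2 a : 'Z_7, square7 a & forall t : 'Z_7, s t = a * t + s 0)
          (s \in col_aut P K7_col).
Proof.
rewrite inE /emb_aut K7_graph_aut (negPf (K7_no_reversing s)) orbF /=.
apply: (iffP andP) => [[ps /forallP/(_ true)/eqP clE]|[a sq sE]].
  exists (s 1 - s 0); last exact: K7_preserving_affine.
  (* The dart (0, 1) has square difference 1, and its image has difference [s 1 - s 0]. *)
  have xy : (0 : 'Z_7) != 1 by [].
  have: face_im P s (face_of P (K7_dart xy)) \in color_class P K7_col true.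
    by rewrite -clE; apply/imset_f/color_classP; exists (K7_dart xy).
  by rewrite face_im_face_of // inE K7_col_face K7_dart_imE => /andP[_ /eqP].
have ps : rho_preserving P s.
  apply/K7_preservingP => x y; rewrite sE (sE x) (sE y); apply/eqP.
  by move: x y a (s 0) {sq sE}; apply: all7_4; vm_compute.
(* [face_im] is injective here, so one inclusion suffices. *)
split=> //; apply/forallP => c; rewrite eqEcard; apply/andP; split; last first.
  rewrite card_imset // /face_im ps; exact/imset_inj/K7_dart_im_inj.
apply/subsetP => _ /imsetP[_ /color_classP[d -> <-] ->].
rewrite face_im_face_of //; apply/color_classP; exists (dart_im s d) => //.
(* The difference of the dart gets multiplied by the square [a]. *)
rewrite K7_dart_imE /= sE (sE (val d).1) opprD addrACA subrr addr0 -mulrBr.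
apply/eqP; apply: (implyP _ sq); move: a ((val d).2 - (val d).1) {sq sE}.
by apply: all7_2; vm_compute.
Qed.

(** * The group generated by shift and doubling *)

Lemma double7_inj : injective (fun t : 'Z_7 => 2 * t).
Proof.
by apply: (can_inj (g := fun t => 4 * t)) => t; apply/eqP; move: t;
   apply/all7P; vm_compute.
Qed.

Definition shift7 : {perm K7} := perm (addIr (1 : 'Z_7)).
Definition double7 : {perm K7} := perm double7_inj.

Lemma shift7X n (t : 'Z_7) : (shift7 ^+ n)%g t = t + n%:R.
Proof.
elim: n => [|n IHn]; first by rewrite expg0 perm1 addr0.
by rewrite expgSr permM IHn permE -addrA -natr1.
Qed.

Lemma double7X n (t : 'Z_7) : (double7 ^+ n)%g t = 2 ^+ n * t.
Proof.
elim: n => [|n IHn]; first by rewrite expg0 perm1 mul1r.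
by rewrite expgSr permM IHn permE exprS mulrA.
Qed.

Lemma shift7_col_aut : shift7 \in col_aut P K7_col.
Proof. by apply/K7_col_autP; exists 1 => // t; rewrite !permE mul1r add0r. Qed.

Lemma double7_col_aut : double7 \in col_aut P K7_col.
Proof. by apply/K7_col_autP; exists 2 => // t; rewrite !permE mulr0 addr0. Qed.

Lemma shift7_exp7 : (shift7 ^+ 7 = 1)%g.
Proof.
apply/permP => t; rewrite shift7X perm1; apply/eqP; move: t.
by apply/all7P; vm_compute.
Qed.

Lemma double7_exp3 : (double7 ^+ 3 = 1)%g.
Proof.
apply/permP => t; rewrite double7X perm1; apply/eqP; move: t.
by apply/all7P; vm_compute.
Qed.

(** Products apply the left factor first, so the relation amounts to 2 (t + 1) = 2 t + 2. *)
Lemma shift7_conj : (shift7 ^ double7 = shift7 ^+ 2)%g.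
Proof.
apply: (mulgI double7); rewrite -conjgC; apply/permP => t.
by rewrite !permM !permE mulrDr mulr1 -addrA.
Qed.

Lemma order_shift7 : #[shift7]%g = 7%N.
Proof.
apply: nt_prime_order shift7_exp7 _ => //.
by apply/eqP => /permP/(_ (0 : 'Z_7)); rewrite permE perm1.
Qed.

Lemma order_double7 : #[double7]%g = 3%N.
Proof.
apply: nt_prime_order double7_exp3 _ => //.
by apply/eqP => /permP/(_ (1 : 'Z_7)); rewrite permE perm1.
Qed.

Lemma col_aut_gen : (<[shift7]> <*> <[double7]> = col_aut P K7_col)%g.
Proof.
apply/eqP; rewrite eqEsubset join_subG !cycle_subG.
rewrite shift7_col_aut double7_col_aut /=.
apply/subsetP => s /K7_col_autP[a sq sE].
have [n an] : exists n, a = 2 ^+ n.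
  by move: sq; rewrite /square7 !inE => /or3P[] /eqP->;
    [exists 0|exists 1|exists 2]; apply/eqP.
have -> : s = (double7 ^+ n * shift7 ^+ val (s 0))%g.
  by apply/permP => t; rewrite permM shift7X double7X sE an natr_Zp.
by rewrite groupM // groupX // mem_gen // inE cycle_id ?orbT.
Qed.

(** * Presentation of F21 and the isomorphism *)

(** The presentation needs an automorphism of ['Z_7] of order dividing 3 that doubles the generator:
    multiplication by the unit 2, as 2^3 = 1. *)
Lemma F21_presentation :
  [set: Extremal.gtype 7 3 2] \isog Grp (x : y : x ^+ 7, y ^+ 3, x ^ y = x ^+ 2).
Proof.
apply: Extremal.Grp => //.
have u2 : (2%:R : 'Z_#[Zp1 : 'Z_7]%g)%R \is a GRing.unit.
  by rewrite order_Zp1 unitZpE.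
exists (Zp_unitm (FinRing.unit _ u2)); split; first exact: Aut_aut.
  rewrite order_injm ?injm_Zp_unitm ?inE // order_dvdn.
  by apply/eqP/val_inj; rewrite /= order_Zp1; apply: val_inj.
by rewrite autE ?cycle_id //= order_Zp1.
Qed.

Lemma K7_col_aut_isog : (col_aut_group P K7_col \isog F21)%g.
Proof.
have homF : (col_aut P K7_col \homg F21)%g.
  rewrite (F21_presentation (col_aut_group P K7_col)).
  apply/existsP; exists (shift7, double7) => /=; apply/eqP.
  by rewrite col_aut_gen shift7_exp7 double7_exp3 shift7_conj.
(* A quotient of [F21] with at least 21 elements is isomorphic to it. *)
rewrite isogEcard homF card_F21 /=.
have: (7 * 3 %| #|col_aut P K7_col|)%N.
  rewrite Gauss_dvd // -order_shift7 -order_double7.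
  by rewrite (order_dvdG shift7_col_aut) (order_dvdG double7_col_aut).
by apply: dvdn_leq; apply: cardG_gt0.
Qed.

End HeawoodEmbedding.

Theorem theorem4p4 :
  [/\ [/\ forall F, F \in faces K7_embedding -> #|F| = 3,
          {in faces K7_embedding &, injective (@face_vertices K7)}
        & @face_vertices K7 @: faces K7_embedding = triangles3 :|: triangles5],
      face_2coloring K7_embedding K7_col,
      (@face_vertices K7 @: color_class K7_embedding K7_col true = triangles3
        /\ #|color_class K7_embedding K7_col true| = 7),
      (@face_vertices K7 @: color_class K7_embedding K7_col false = triangles5
        /\ #|color_class K7_embedding K7_col false| = 7)
    & (col_aut_group K7_embedding K7_col \isog F21)%g].
Proof.
split.
- split; [exact: card_face | exact: face_vertices_inj |].
  by rewrite faces_color_class imsetU !color_class_triangles.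
- exact: K7_face_2coloring.
- by rewrite color_class_triangles card_color_class.
- by rewrite color_class_triangles card_color_class.
- exact: K7_col_aut_isog.
Qed.
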